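(* Let $0<\mu<1$, $0\le\nu\le1$, $\eta=\mu+\nu-\mu\nu$, $a\in\mathbb{R}$. Let $u,v:\mathbb{N}_a\to\mathbb{R}$ be nonnegative functions with $|v(x)|<1$ for all $x\in\mathbb{N}_a$, and suppose that $$u(x)\le u(a)\,h_{\eta-1}(x,a+1-\eta)+\Delta_{a+1-\mu}^{-\mu}\big[v(\cdot+\mu-1)\,u(\cdot+\mu-1)\big](x)\qquad\text{for all }x\in\mathbb{N}_{a+1}.$$ Then, for all $x\in\mathbb{N}_a$, $$u(x)\le\frac{u(a)}{\Gamma(\eta)}\sum_{\ell=0}^{\infty}\big(E_v^{\ell}\varphi_0\big)(x),\qquad \varphi_0(x)=(x+\eta-a-1)^{\underline{\eta-1}}.$$
   Context: For $b\in\mathbb{R}$, $\mathbb{N}_b=\{b,b+1,b+2,\dots\}$; $\sigma(t)=t+1$; $t^{\underline{\alpha}}=\Gamma(t+1)/\Gamma(t+1-\alpha)$ (value $0$ if only the denominator has a pole); $h_{\alpha}(t,s)=\frac{(t-s)^{\underline{\alpha}}}{\Gamma(\alpha+1)}$. Delta fractional sum: for $\alpha>0$ and $f:\mathbb{N}_b\to\mathbb{R}$, $\Delta_b^{-\alpha}f(x)=\sum_{\tau=b}^{x-\alpha}h_{\alpha-1}(x,\sigma(\tau))f(\tau)$ for $x\in\mathbb{N}_{b+\alpha}$; empty sums are $0$. Operator $E_v$: for $\varphi:\mathbb{N}_a\to\mathbb{R}$, $(E_v\varphi)(x)=\Delta_{a+1-\mu}^{-\mu}[v(\cdot+\mu-1)\varphi(\cdot+\mu-1)](x)=\sum_{\tau=a+1-\mu}^{x-\mu}h_{\mu-1}(x,\sigma(\tau))\,v(\tau+\mu-1)\,\varphi(\tau+\mu-1)$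 for $x\in\mathbb{N}_a$ (so $(E_v\varphi)(a)=0$ by the empty sum convention). $E_v^0$ is the identity and $E_v^{\ell}$ is the $\ell$-fold iterate. *)

(* Defs.v *)
From HB Require Import structures.
From mathcomp Require Import all_boot all_order all_algebra.
From mathcomp Require Import all_classical all_reals all_analysis.

Set Implicit Arguments.
Unset Strict Implicit.
Unset Printing Implicit Defensive.

Import Order.TTheory GRing.Theory Num.Theory.
Import numFieldNormedType.Exports.

Local Open Scope classical_set_scope.
Local Open Scope ring_scope.

Section DiscreteFractionalCalculus.
Context {R : realType}.
Implicit Types (a b c t s x alpha mu : R) (f v phi : R -> R).

(* A function on N_b is represented by a total function R -> R, whose values
   outside N_b are irrelevant. *)
Definition natset b : set R := [set x | exists n : nat, x = b + n%:R].

Definition sigma t : R := t + 1.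

(* Euler's integral; it converges (and is meaningful) only for 0 < x. *)
Definition euler_integral x : R :=
  \int[lebesgue_measure]_(t in `]0, +oo[) (t `^ (x - 1) * expR (- t)).

(* Euler's integral, continued to x <= 0 by
     Gamma x = Gamma (x + n) / (x (x + 1) ... (x + n - 1)),
   where n = truncn (1 - x) is the least natural number with 0 < x + n, so
   that n = 0 when 0 < x.  At the poles 0, -1, -2, ... a factor of the
   denominator vanishes and Gamma takes the junk value 0. *)
Definition Gamma x : R :=
  let n := Num.truncn (1 - x) in
  euler_integral (x + n%:R) / \prod_(i < n) (x + i%:R).

(* Falling power.  If only the denominator has a pole, then its junk value 0
   makes the quotient 0, which is the usual convention. *)
Definition fallpow t alpha : R := Gamma (t + 1) / Gamma (t + 1 - alpha).

Definition h alpha t s : R := fallpow (t - s) alpha / Gamma (alpha + 1).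

(* The sum of f tau over all tau in N_b with tau <= c: the number of terms is
   floor (c - b) + 1 if b <= c, and 0 otherwise (truncn is 0 on negatives). *)
Definition dsum b c f : R :=
  \sum_(0 <= k < Num.truncn (c - b + 1)) f (b + k%:R).

(* Delta fractional sum of order alpha, i.e. Delta_b^{-alpha} f (x). *)
Definition fracsum alpha b f x : R :=
  dsum b (x - alpha) (fun tau => h (alpha - 1) x (sigma tau) * f tau).

Definition E_op a mu v phi : R -> R :=
  fracsum mu (a + 1 - mu) (fun t => v (t + mu - 1) * phi (t + mu - 1)).

End DiscreteFractionalCalculus.

(* Main.v *)
Require Import Defs.
From HB Require Import structures.
From mathcomp Require Import all_boot all_order all_algebra.
From mathcomp Require Import all_classical all_reals all_analysis.
From mathcomp Require Import measurable_realfun ring lra.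
Set Implicit Arguments.
Unset Strict Implicit.
Unset Printing Implicit Defensive.
Import Order.TTheory GRing.Theory Num.Theory.
Import numFieldNormedType.Exports.
Local Open Scope classical_set_scope.
Local Open Scope ring_scope.

(** The value of [E_op a mu v f] at [a + n] is a combination of the values of
    [f] at [a], ..., [a + (n - 1)] only, with nonnegative coefficients
    when [v >= 0] ([E_op_nat], [E_kernel_ge0]).  So on the points [a + n] the operator [E] is linear, monotone
    and strictly lower triangular, and its [l]-th iterate vanishes at [a + n] as
    soon as [n < l] ([iter_E_op_eq0]).  The Neumann series of [E] is therefore a
    finite sum at each point, and converges.

    With [c = u a / Gamma eta] the hypothesis reads [u <= c * phi0 + E u].
    Feeding this inequality into itself [N] times, by monotonicity and
    linearity, gives
      [u <= c * (phi0 + E phi0 + ... + E^(N-1) phi0) + E^N u]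
    ([le_series_iter_E_op]), and at [a + n] the remainder [E^N u] is zero for
    [N > n]: what is left is the claim.

    The assumed inequality starts at [a + 1], and at [a] it has to be
    supplied: there [phi0 a = Gamma eta / Gamma 1], so that it amounts to
    [u a <= u a], provided that [Gamma 1 = 1] and that [Gamma eta] is a nonzero
    real number.  As [Gamma] is an integral that would be [0] if it diverged,
    the latter requires Euler's integral to be shown finite for
    [0 < eta <= 1] ([Gamma_gt0_le1]). *)

(** * Euler's integral *)

Section Gamma.
Variable R : realType.
Implicit Types s x t : R.
Local Notation leb := (@lebesgue_measure R).

Lemma Gamma_gt0E x : 0 < x -> Gamma x = euler_integral x.
Proof.
move=> x0; rewrite /Gamma.
have -> : Num.truncn (1 - x) = 0%N by apply/truncn0Pn; rewrite -ltNge; lra.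
by rewrite big_ord0 divr1 addr0.
Qed.

Local Notation euler_integrand s t := (t `^ (s - 1) * expR (- t))%:E.

Lemma euler_integrand_ge0 s t : (0 <= euler_integrand s t)%E.
Proof. by rewrite lee_fin mulr_ge0 ?powR_ge0 ?expR_ge0. Qed.

Lemma measurable_euler_integrand s (D : set R) :
  measurable_fun D (fun t => euler_integrand s t).
Proof.
apply: measurable_funTS; apply/measurable_EFinP.
by apply: measurable_funM => //; exact: measurableT_comp.
Qed.

Lemma Gamma_ge0 x : 0 < x -> 0 <= Gamma x.
Proof.
move=> x0; rewrite Gamma_gt0E//; apply: Rintegral_ge0 => t _.
by rewrite mulr_ge0 ?powR_ge0 ?expR_ge0.
Qed.

(** The density of the exponential law of rate [1] restricts to [expR (- t)] on
    the half-line, and has total mass [1]. *)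
Lemma integral_expRN_itv0y : (\int[leb]_(t in `[0%R, +oo[) (expR (- t))%:E = 1)%E.
Proof.
rewrite -(@integral_exponential_pdf R 1)// integral_mkcond.
apply: eq_integral => t _; rewrite /exponential_pdf !patchE.
by case: ifP; rewrite // mul1r mulN1r.
Qed.

Lemma measurable_expRN (D : set R) : measurable_fun D (fun t => (expR (- t))%:E).
Proof.
by apply: measurable_funTS; apply/measurable_EFinP; exact: measurableT_comp.
Qed.

Lemma Gamma1 : Gamma 1 = 1 :> R.
Proof.
rewrite Gamma_gt0E// /euler_integral /Rintegral.
under eq_integral do rewrite subrr powRr0 mul1r.
rewrite integral_itv_obnd_cbnd; last exact: measurable_expRN.
by rewrite integral_expRN_itv0y.
Qed.

Lemma integral_powR_itv s (e : R) : 0 < s -> 0 < e < 1 ->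
  (\int[leb]_(t in `[e, 1%R]) (t `^ (s - 1))%:E = (s^-1 * (1 - e `^ s))%:E)%E.
Proof.
move=> s0 /andP[e0 e1].
have dF t : 0 < t -> derivable (fun x => s^-1 * x `^ s) t 1.
  move=> t0; apply: derivableM => //.
  by apply: derivable_powR; rewrite in_itv/= t0.
have cF t : 0 < t -> {for t, continuous (fun x => s^-1 * x `^ s)}.
  by move=> t0; apply: differentiable_continuous; apply/derivable1_diffP/dF.
rewrite (@continuous_FTC2 _ _ (fun x => s^-1 * x `^ s))//.
- by rewrite powR1 -EFinB mulrBr mulr1.
- apply: continuous_in_subspaceT => t.
  rewrite inE/= in_itv/= => /andP[et _].
  apply: differentiable_continuous; apply/derivable1_diffP/derivable_powR.
  by rewrite in_itv/= (lt_le_trans e0 et).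
- split.
  + by move=> t; rewrite in_itv/= => /andP[et _]; apply: dF; exact: lt_trans et.
  + by apply: cvg_at_right_filter; exact: cF.
  + by apply: cvg_at_left_filter; exact: cF.
- move=> t; rewrite in_itv/= => /andP[et _].
  have t0 : 0 < t by exact: lt_trans et.
  rewrite derive1Ml; last by apply: derivable_powR; rewrite in_itv/= t0.
  rewrite powR_derive1 ?in_itv/= ?t0//.
  by rewrite mulrA mulVf ?mul1r// gt_eqF.
Qed.

(** The integrand is unbounded at [0] when [s < 1], so the integral is the
    limit of its values from [1/(n+2)] to [1], which increase and stay below
    [s^-1]. *)
Lemma integral_powR_itv01_le s : 0 < s ->
  (\int[leb]_(t in `]0%R, 1%R]) (t `^ (s - 1))%:E <= (s^-1)%:E)%E.
Proof.
move=> s0; pose F n : set R := `[(n.+2%:R)^-1, 1]%classic.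
have n2 n : 0 < (n.+2%:R^-1 : R) < 1.
  by rewrite invr_gt0 ltr0n/= invf_lt1 ?ltr0n// ltr1n.
have <- : \bigcup_n F n = `]0, 1]%classic.
  apply/seteqP; split => [t [n _]|t]; rewrite /F/= !in_itv/=.
    move=> /andP[nt ->]; rewrite andbT; apply: lt_le_trans nt.
    by have /andP[] := n2 n.
  move=> /andP[t0 t1]; exists (Num.truncn t^-1) => //=.
  rewrite in_itv/= t1 andbT invf_ple ?posrE ?ltr0n//.
  by rewrite (le_trans (ltW (truncnS_gt _)))// ler_nat.
have mf (D : set R) : measurable_fun D (fun t : R => (t `^ (s - 1))%:E).
  by apply: measurable_funTS; apply/measurable_EFinP; exact: measurable_powR.
have ndF : {homo F : n m / (n <= m)%N >-> (n <= m)%O}.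
  move=> n m nm; rewrite subsetEset; apply: subset_itvr.
  by rewrite bnd_simp lef_pV2 ?posrE ?ltr0n// ler_nat.
have f0 t : (0 <= (t `^ (s - 1))%:E)%E by rewrite lee_fin powR_ge0.
have cvgF : (\int[leb]_(t in F n) (t `^ (s - 1))%:E @[n --> \oo] -->
    \int[leb]_(t in \bigcup_n F n) (t `^ (s - 1))%:E)%E.
  apply: ge0_nondecreasing_set_cvg_integral => // n; last exact: mf.
  by rewrite /F; exact: measurable_itv.
rewrite -(cvg_lim _ cvgF)//; apply: lime_le; first exact: cvgP cvgF.
apply: nearW => n; rewrite integral_powR_itv// lee_fin.
by rewrite ler_piMr ?invr_ge0 ?ltW// gerBl powR_ge0.
Qed.

(** Up to [1] the integrand lies between [expR (- 1)] and [t `^ (s - 1)],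
    and beyond [1] it is at most [expR (- t)]: the lower bound gives positivity
    of the integral, the upper bounds its finiteness. *)
Lemma Gamma_gt0_le1 s : 0 < s <= 1 -> 0 < Gamma s.
Proof.
move=> /andP[s0 s1]; rewrite Gamma_gt0E//.
apply: fine_gt0; apply/andP; split.
  apply: (@lt_le_trans _ _ (\int[leb]_(t in `]0%R, 1%R]) (expR (- 1))%:E)%E).
    rewrite integral_cst//= lebesgue_measure_itv/= lte_fin ltr01.
    by rewrite -EFinD subr0 mule1 lte_fin expR_gt0.
  apply: (@le_trans _ _ (\int[leb]_(t in `]0%R, 1%R]) euler_integrand s t)%E).
    apply: ge0_le_integral => //.
    - exact: measurable_euler_integrand.
    - move=> t /=; rewrite in_itv/= => /andP[t0 t1]; rewrite lee_fin.
      rewrite -[leLHS]mul1r ler_pM ?expR_ge0 ?ler_expR ?lerN2//.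
      rewrite -[leLHS](powRr0 t); apply: ger_powR; first by rewrite t0.
      by rewrite subr_le0.
  apply: ge0_subset_integral => //.
  - exact: measurable_euler_integrand.
  - by move=> t _; exact: euler_integrand_ge0.
  - by apply: subset_itvl.
rewrite (@itv_bndbnd_setU _ _ _ (BRight 1)) ?bnd_simp//.
rewrite ge0_integral_setU//; last 3 first.
- exact: measurable_euler_integrand.
- by move=> t _; exact: euler_integrand_ge0.
- rewrite disj_set2E; apply/eqP/seteqP; split => // t [] /=.
  by rewrite !in_itv/= => /andP[_ t1]; rewrite ltNge t1.
apply: lte_add_pinfty.
  apply: (@le_lt_trans _ _ (\int[leb]_(t in `]0%R, 1%R]) (t `^ (s - 1))%:E)%E);
    last exact: le_lt_trans (integral_powR_itv01_le s0) (ltry _).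
  apply: ge0_le_integral => //.
  - by move=> t _; exact: euler_integrand_ge0.
  - exact: measurable_euler_integrand.
  - by apply: measurable_funTS; apply/measurable_EFinP; exact: measurable_powR.
  - move=> t /=; rewrite in_itv/= => /andP[t0 t1]; rewrite lee_fin.
    by rewrite ler_piMr ?powR_ge0// expR_le1 oppr_le0 ltW.
apply: (@le_lt_trans _ _ (\int[leb]_(t in `]1%R, +oo[) (expR (- t))%:E)%E).
  apply: ge0_le_integral => //.
  - by move=> t _; exact: euler_integrand_ge0.
  - exact: measurable_euler_integrand.
  - exact: measurable_expRN.
  - move=> t /=; rewrite in_itv/= andbT => t1; rewrite lee_fin.
    rewrite ler_piMl ?expR_ge0// -[leRHS](powRr0 t).
    by apply: ler_powR; rewrite ?subr_le0// ltW.
apply: (@le_lt_trans _ _ 1%E); last exact: ltry.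
rewrite -integral_expRN_itv0y; apply: ge0_subset_integral => //.
- exact: measurable_expRN.
- by apply: subset_itvr; rewrite bnd_simp.
Qed.
End Gamma.

(** * The operator E on the points a + n *)

Section NeumannSeries.
Context {R : realType}.
Implicit Types (mu a c : R) (v f g u : R -> R) (n k l N : nat).

Lemma natset_nat a n : natset a (a + n%:R).
Proof. by exists n. Qed.

Definition E_kernel mu a n k : R :=
  h (mu - 1) (a + n%:R) (sigma (a + 1 - mu + k%:R)).

(** For [k < n] the kernel is [Gamma (n - k - 1 + mu) / Gamma (n - k) / Gamma mu],
    in which every argument of [Gamma] is positive. *)
Lemma E_kernel_ge0 mu a n k : 0 < mu -> (k < n)%N -> 0 <= E_kernel mu a n k.
Proof.
move=> mu0 kn; rewrite /E_kernel /h /fallpow /sigma !subrK.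
have nk : k%:R + 1 <= n%:R :> R by rewrite natr1 ler_nat.
by apply: divr_ge0; [apply: divr_ge0|]; apply: Gamma_ge0; lra.
Qed.

Lemma E_op_nat mu a v f n :
  E_op a mu v f (a + n%:R) =
  \sum_(k < n) E_kernel mu a n k * (v (a + k%:R) * f (a + k%:R)).
Proof.
rewrite /E_op /fracsum /dsum.
have -> : a + n%:R - mu - (a + 1 - mu) + 1 = n%:R by ring.
rewrite natrK big_mkord; apply: eq_bigr => k _.
by have -> : a + 1 - mu + k%:R + mu - 1 = a + k%:R by ring.
Qed.

Lemma E_op_lin mu a v c f g (x : R) :
  E_op a mu v (fun y => c * f y + g y) x = c * E_op a mu v f x + E_op a mu v g x.
Proof.
rewrite /E_op /fracsum /dsum mulr_sumr -big_split/=.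
by apply: eq_bigr => k _; ring.
Qed.

Lemma le_E_op mu a v f g :
  0 < mu -> (forall x, natset a x -> 0 <= v x) ->
  (forall x, natset a x -> f x <= g x) ->
  forall x, natset a x -> E_op a mu v f x <= E_op a mu v g x.
Proof.
move=> mu0 v0 fg _ [n ->]; rewrite !E_op_nat; apply: ler_sum => k _.
by rewrite ler_wpM2l ?E_kernel_ge0// ler_wpM2l ?v0 ?fg//; exact: natset_nat.
Qed.

(** Each application of [E] shifts the support of a function one step further
    away from [a]. *)
Lemma iter_E_op_eq0 mu a v f l n : (n < l)%N ->
  iter l (E_op a mu v) f (a + n%:R) = 0.
Proof.
elim: l n => // l IH n; rewrite ltnS => nl /=.
rewrite E_op_nat big1// => k _.
by rewrite IH ?mulr0// (leq_trans (ltn_ord k)).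
Qed.

Lemma iter_E_op_lin mu a v l c f g (x : R) :
  iter l (E_op a mu v) (fun y => c * f y + g y) x =
  c * iter l (E_op a mu v) f x + iter l (E_op a mu v) g x.
Proof.
elim: l x => //= l IH x; rewrite -E_op_lin.
by congr (E_op a mu v _ x); apply/funext => y; exact: IH.
Qed.

Lemma le_iter_E_op mu a v l f g :
  0 < mu -> (forall x, natset a x -> 0 <= v x) ->
  (forall x, natset a x -> f x <= g x) ->
  forall x, natset a x -> iter l (E_op a mu v) f x <= iter l (E_op a mu v) g x.
Proof. by move=> mu0 v0 fg; elim: l => //= l IH; exact: le_E_op. Qed.

Lemma series_iter_E_op mu a v f n N : (n < N)%N ->
  series (fun l => iter l (E_op a mu v) f (a + n%:R)) N =
  series (fun l => iter l (E_op a mu v) f (a + n%:R)) n.+1.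
Proof.
move=> nN; apply/eqP; rewrite -subr_eq0 sub_series_geq// big_nat.
by rewrite big1// => l /andP[nl _]; rewrite iter_E_op_eq0.
Qed.

(** Induction on [N]: applying the monotone linear map [E^N] to the hypothesis
    turns the remainder [E^N u] into [c * E^N f] plus the remainder of order
    [N + 1]. *)
Lemma le_series_iter_E_op mu a v c f u N :
  0 < mu -> (forall x, natset a x -> 0 <= v x) ->
  (forall x, natset a x -> u x <= c * f x + E_op a mu v u x) ->
  forall x, natset a x ->
    u x <= c * series (fun l => iter l (E_op a mu v) f x) N +
           iter N (E_op a mu v) u x.
Proof.
move=> mu0 v0 u_le; elim: N => [x _|N IH x ax].
  by rewrite /series/= big_geq// mulr0 add0r.
apply: le_trans (IH x ax) _; rewrite seriesSr mulrDr -addrA lerD2l.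
by apply: le_trans (le_iter_E_op N mu0 v0 u_le ax) _; rewrite iter_E_op_lin -iterSr.
Qed.
End NeumannSeries.

(** * The Gronwall inequality *)

Theorem theorem5p3 (R : realType) (mu nu eta a : R) (u v : R -> R)
  (hmu0 : 0 < mu) (hmu1 : mu < 1)
  (hnu0 : 0 <= nu) (hnu1 : nu <= 1)
  (heta : eta = mu + nu - mu * nu)
  (hu : forall x : R, natset a x -> 0 <= u x)
  (hv : forall x : R, natset a x -> 0 <= v x)
  (hv1 : forall x : R, natset a x -> `|v x| < 1)
  (hineq : forall x : R, natset (a + 1) x ->
     u x <= u a * h (eta - 1) x (a + 1 - eta)
            + fracsum mu (a + 1 - mu)
                (fun t => v (t + mu - 1) * u (t + mu - 1)) x) :
  let phi0 : R -> R := fun x => fallpow (x + eta - a - 1) (eta - 1) in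
  forall x : R, natset a x ->
    cvgn [series iter l (E_op a mu v) phi0 x]_l /\
    u x <= u a / Gamma eta * limn [series iter l (E_op a mu v) phi0 x]_l.
Proof.
move=> phi0.
have eta01 : 0 < eta <= 1 by rewrite heta; apply/andP; split; nra.
have G0 : Gamma eta != 0 by rewrite gt_eqF// Gamma_gt0_le1.
have u_le x : natset a x ->
    u x <= u a / Gamma eta * phi0 x + E_op a mu v u x.
  move=> [[|n] ->].
    (* At [a] both sides are equal: [phi0 a = Gamma eta / Gamma 1]. *)
    rewrite E_op_nat big_ord0 !addr0 /phi0 /fallpow.
    have -> : a + eta - a - 1 + 1 = eta by ring.
    have -> : eta - (eta - 1) = 1 by ring.
    by rewrite Gamma1 divr1 divfK.
  have -> : u a / Gamma eta * phi0 (a + n.+1%:R) =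
      u a * h (eta - 1) (a + n.+1%:R) (a + 1 - eta).
    rewrite /h /phi0 subrK -mulrA [_^-1 * _]mulrC.
    by congr (_ * (fallpow _ _ / _)); ring.
  by apply: hineq; exists n; rewrite -addrA nat1r.
move=> _ [n ->].
have near_sum : \forall N \near \oo,
    [series iter l (E_op a mu v) phi0 (a + n%:R)]_l N =
    [series iter l (E_op a mu v) phi0 (a + n%:R)]_l n.+1.
  by exists n.+1 => // N /= nN; exact: series_iter_E_op.
split; first exact: is_cvg_near_cst near_sum.
rewrite (lim_near_cst _ near_sum)//.
have := le_series_iter_E_op n.+1 hmu0 hv u_le (natset_nat a n).
by rewrite iter_E_op_eq0// addr0.
Qed.
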